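(* Let $\delta\in(0,1)$, $\vartheta>0$, $\alpha\in(0,1/2)$ and $\mathcal{C}_{n,\alpha}=[\alpha n,(1-\alpha)n]$. Suppose that the observed Gaussian vector $\boldsymbol X=(X_1,\dots,X_n)^\top$ has covariance matrix $\Sigma_n=\mathcal{T}_n(f)=[f_{|r-s|}]_{r,s=1}^n$, where $f:[-\pi,\pi]\to\mathbb{R}$ is a real symmetric function with Fourier coefficients $\{f_m\}$ satisfying: (a) $0<m_f:=\inf_{\omega}f(\omega)\le M_f:=\sup_{\omega}f(\omega)<\infty$; (b) for some positive constants $c,\lambda$, $|f_k|\le c(1+k)^{-(1+\lambda)}$ for all integers $k\ge0$. Consider the CUSUM test $T_{CUSUM}$ described in the context. There are $n_0=n_0(f,\vartheta)$, a universal constant $C(\lambda,c)>0$ and thresholds $R_{n,\delta}>0$ such that if $n\ge n_0$ and $$|b|\ge C\sqrt{\frac{(1+\vartheta)f(0)}{n\alpha(1-\alpha)}\log\left(\frac{n(1-2\alpha)}{\delta}\right)},$$ then $\varphi_n(T_{CUSUM})\le\delta$.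
   Context: Increasing domain setting: $\{X_k\}_{k\ge1}$ is a Gaussian sequence with $\mathrm{cov}(X_r,X_s)=f_{|r-s|}$, normalized so that $f_0=1$. Here $f_m=\frac1{2\pi}\int_{-\pi}^{\pi}f(\omega)e^{-jm\omega}d\omega$, and $f$ equals its (absolutely convergent) Fourier series, so $f(0)=\sum_{m\in\mathbb{Z}}f_m$. Testing problem: change points $t$ range over the integers in $\mathcal{C}_{n,\alpha}$. Let $\zeta_t\in\mathbb{R}^n$ have $\zeta_t(k)=-1$ for $k\le t$ and $+1$ for $k>t$. The null hypothesis is $\mathbb{H}_0:\mathbb{E}\boldsymbol X=0$; the alternative with change point $t$ and jump $b\ne0$ is $\mathbb{H}_{1,t}:\mathbb{E}\boldsymbol X=\frac b2\zeta_t$ (same covariance). The CUSUM test with threshold $R_{n,\delta}$ is $$T_{CUSUM}=\mathbb{1}\left\{\max_{t\in\mathcal{C}_{n,\alpha}}\sqrt{\frac{t(n-t)}n}\left|\frac1{n-t}\sum_{k=t+1}^nX_k-\frac1t\sum_{k=1}^tX_k\right|\ge R_{n,\delta}\right\}.$$ For a test $T\in\{0,1\}$, $\varphi_n(T)=\mathbb{P}(T=1\mid\mathbb{H}_0)+\max_{t\in\mathcal{C}_{n,\alpha}}\mathbb{P}(T=0\mid\mathbb{H}_{1,t})$, where under $\mathbb{H}_{1,t}$ the jump size is $b$.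
   Formalization: The sample-size threshold n_0 may depend on α as well as on f and ϑ; an n_0 uniform in α is impossible, since for even n and α near 1/2 the logarithm can be arbitrarily close to 0, so arbitrarily small jumps b would be admitted. *)

(* Defs.v *)
From HB Require Import structures.
From mathcomp Require Import all_boot all_order all_algebra.
From mathcomp Require Import all_classical all_reals all_analysis.
From mathcomp Require Import complex.

Set Implicit Arguments.
Unset Strict Implicit.
Unset Printing Implicit Defensive.

Import Order.TTheory GRing.Theory Num.Theory.
Import numFieldNormedType.Exports.

Local Open Scope classical_set_scope.
Local Open Scope ring_scope.
Local Open Scope complex_scope.

Definition cexpi (R : realType) (x : R) : R[i] := cos x +i* sin x.

(* Integral of a complex-valued function, componentwise. *)
Definition cintegral (R : realType) (D : set R) (g : R -> R[i]) : R[i] :=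
  Rintegral lebesgue_measure D (fun x => complex.Re (g x)) +i*
  Rintegral lebesgue_measure D (fun x => complex.Im (g x)).

Definition fourier_coef (R : realType) (f : R -> R) (m : int) : R[i] :=
  ((2 * pi)^-1)%:C *
  cintegral `[- pi, pi] (fun w => (f w)%:C * cexpi (- (m%:~R * w))).

(* The sum over - N <= m <= N of f_m exp(j m w), with the index shifted
   to m = k - N. *)
Definition fourier_sum (R : realType) (f : R -> R) (N : nat) (w : R) : R[i] :=
  \sum_(k < N.*2.+1)
    fourier_coef f (k%:Z - N%:Z) * cexpi ((k%:Z - N%:Z)%:~R * w).

(* Only the values of f on [-pi, pi] matter.  Absolute convergence of the
   Fourier series follows from the decay of the coefficients. *)
Record spectral_density (R : realType) (c lambda : R) (f : R -> R) : Prop :=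
  SpectralDensity {
    spd_integrable :
      lebesgue_measure.-integrable (`[- pi, pi] : set R) (EFin \o f);
    spd_sym : forall w : R, w \in `[- pi, pi] -> f (- w) = f w;
    spd_inf_gt0 :
      (0 < ereal_inf ((EFin \o f) @` `[(- pi)%R, pi]))%E;
    spd_sup_lty :
      (ereal_sup ((EFin \o f) @` `[(- pi)%R, pi]) < +oo)%E;
    spd_decay : forall k : nat,
      `|fourier_coef f k%:Z| <= (c * (1 + k%:R) `^ (- (1 + lambda)))%:C;
    spd_series : forall w : R, w \in `[- pi, pi] ->
      (fourier_sum f N w : R[i]^o) @[N --> \oo] --> ((f w)%:C : R[i]^o);
    spd_normalized : fourier_coef f 0 = 1 }.

Definition toeplitz (R : realType) (n : nat) (f : R -> R) : 'M[R[i]]_n :=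
  \matrix_(r < n, s < n) fourier_coef f `|r%:Z - s%:Z|.

(* The library's [normal_prob m 0] is not the degenerate law at [m]. *)
Definition gaussian_law (R : realType) (m s : R) (A : set R) : \bar R :=
  if s == 0 then \d_m A else normal_prob m s A.

(* The coordinates of X are jointly Gaussian under P, with mean mu and
   covariance matrix Sigma. *)
Record gaussian_vector (R : realType) (d : measure_display)
    (T : measurableType d) (P : probability T R) (n : nat)
    (X : 'I_n -> {mfun T >-> R}) (mu : 'rV[R]_n) (Sigma : 'M[R]_n) : Prop :=
  GaussianVector {
    gv_normal : forall a : 'I_n -> R, exists m s : R,
      forall A : set R, measurable A ->
      P ((fun x => \sum_(k < n) a k * X k x) @^-1` A) = gaussian_law m s A;
    gv_mean : forall k : 'I_n, ('E_P[X k] = (mu ord0 k)%:E)%E;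
    gv_cov : forall r s : 'I_n, covariance P (X r) (X s) = (Sigma r s)%:E }.

Definition change_points (R : realType) (n : nat) (alpha : R) : pred nat :=
  [pred t : nat | alpha * n%:R <= t%:R <= (1 - alpha) * n%:R].

(* Coordinates are numbered from 0: the entry k stands for the sample k + 1,
   so that samples 1, ..., t are the entries k with k < t. *)
Definition zeta (R : realType) (n t : nat) : 'rV[R]_n :=
  \row_(k < n) if (k < t)%N then - 1 else 1.

Definition cusum (R : realType) (n t : nat) (x : 'rV[R]_n) : R :=
  Num.sqrt (t%:R * (n - t)%N%:R / n%:R) *
  `| (n - t)%N%:R^-1 * (\sum_(k < n | (t <= k)%N) x 0 k)
     - t%:R^-1 * (\sum_(k < n | (k < t)%N) x 0 k) |.

(* The default value 0 of the maximum is harmless: all terms are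
   nonnegative, and so are the probabilities in [error_prob]. *)
Definition cusum_test (R : realType) (n : nat) (alpha thr : R)
    (x : 'rV[R]_n) : bool :=
  thr <= \big[Num.max/0]_(t < n.+1 | change_points n alpha t) cusum t x.

Definition observation (R : realType) (d : measure_display)
    (T : measurableType d) (n : nat) (X : 'I_n -> {mfun T >-> R}) (w : T) :
    'rV[R]_n := \row_(k < n) X k w.

(* P0 is the probability under the null hypothesis, P1 t the one under the
   alternative with change point t. *)
Definition error_prob (R : realType) (d : measure_display)
    (T : measurableType d) (n : nat) (alpha : R)
    (X : 'I_n -> {mfun T >-> R}) (P0 : probability T R)
    (P1 : nat -> probability T R) (test : 'rV[R]_n -> bool) : \bar R :=
  (P0 [set w | test (observation X w)] +
   \big[maxe/0]_(t < n.+1 | change_points n alpha t)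
     P1 t [set w | ~~ test (observation X w)])%E.

(* Main.v *)
Require Import Defs.
From HB Require Import structures.
From mathcomp Require Import all_boot all_order all_algebra.
From mathcomp Require Import all_classical all_reals all_analysis.
From mathcomp Require Import measurable_realfun complex.
From mathcomp Require Import ring lra.
Set Implicit Arguments.
Unset Strict Implicit.
Unset Printing Implicit Defensive.
Import Order.TTheory GRing.Theory Num.Theory.
Import numFieldNormedType.Exports.
Local Open Scope classical_set_scope.
Local Open Scope ring_scope.
Local Open Scope complex_scope.

(** Why the theorem is true.  Write kappa_t = sqrt (t (n - t) / n).  The CUSUM
    statistic at t is the absolute value of Z_t = sum_k w_k X_k, where the
    weights w_k equal - kappa_t / t before the change point and
    kappa_t / (n - t) after it.  This Z_t is Gaussian.  Its mean is 0 under the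
    null hypothesis and b kappa_t under the alternative, and its variance v_t
    is the same under both.  So everything rests on v_t <= (1 + vartheta) f(0)
    for large n, uniformly over the change points considered.

    The variance ([cusum_variance], [cusum_variance_le]).  If T1 and T2 are the
    sums of the X_k over the two blocks, then
      Z_t ^ 2 = T1 ^ 2 / t + T2 ^ 2 / (n - t) - (T1 + T2) ^ 2 / n,
    the decomposition of the sum of squares between groups.  By stationarity
    v_t = Q(t) / t + Q(n - t) / (n - t) - Q(n) / n, where Q(N) is the sum of all
    entries of the N x N Toeplitz matrix.  The last row and column of that
    matrix give Q(N + 1) - Q(N) = S_N, the symmetric partial sum of order N of
    the Fourier series of f at 0.  Hence Q(N) / N is the arithmetic mean of
    S_0, ..., S_(N-1), which tends to f(0) by Cesaro's lemma, and v_t is close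
    to f(0) + f(0) - f(0) as soon as t, n - t and n are large.

    The tail ([gaussian_tail]).  A variable with mean mu, variance at most V
    and a Gaussian law satisfies P(|Z - mu| >= x) <= 2 exp (- x^2 / (2 V)).
    This is the Chernoff bound, once the parameters of the law are compared
    with the moments of Z.  Both comparisons come from 1 + y <= exp y:
    averaged at y = t (Z - m) it identifies the mean ([gaussian_law_mean]), and
    averaged at y = - c (Z - m)^2 it bounds s^2 by the variance
    ([gaussian_law_variance_ge]); the averages of the exponentials reduce to
    the total mass of another normal density.

    The conclusion.  Put V = (1 + vartheta) f(0), N = n (1 - 2 alpha),
    L = ln (N / delta), and take the threshold x = 2 sqrt (V L).  The tail bound
    at x is 2 exp (- 2 L) = 2 (delta / N) ^ 2.  At most n + 1 change points
    enter the union bound under the null hypothesis, and N^2 >= 4 (n + 1) for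
    large n, so this costs at most delta / 2.  With C = 4 the lower bound
    on |b| says that |b| kappa_t >= 2 x; missing the change then forces a
    deviation of Z_t from its mean by at least x, which costs at most
    delta / 2 again. *)

(** * Exponential moments of Gaussian variables *)

(** The normal law is absolutely continuous, and its density agrees almost
    everywhere with its Radon-Nikodym derivative. *)
Lemma integral_normal_prob (R : realType) (m s : R) (g : R -> R) :
  measurable_fun setT g -> (forall x, 0 <= g x) ->
  (\int[normal_prob m s]_x (g x)%:E =
   \int[lebesgue_measure]_x (g x * normal_pdf m s x)%:E)%E.
Proof.
move=> mg g0.
have dom : normal_prob m s `<< (@lebesgue_measure R) :=
  @normal_prob_dominates R m s.
have mpdf : measurable_fun setT (EFin \o normal_pdf m s).
  by apply/measurable_EFinP; exact: measurable_normal_pdf.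
have mg' : measurable_fun setT (EFin \o g) by exact/measurable_EFinP.
rewrite -(Radon_Nikodym_SigmaFinite.change_of_variables dom)//.
have iRN := Radon_Nikodym_SigmaFinite.f_integrable dom.
under [RHS]eq_integral do rewrite EFinM.
apply: ae_eq_integral => //.
- by apply: emeasurable_funM => //; exact: measurable_int iRN.
- exact: emeasurable_funM.
apply: ae_eqe_mul2l; apply: integral_ae_eq => //.
by move=> E _ mE; rewrite -Radon_Nikodym_SigmaFinite.f_integral.
Qed.

Lemma integral_gaussian_law (R : realType) (d : measure_display)
    (T : measurableType d) (P : probability T R) (Z : {mfun T >-> R})
    (m s : R) (g : R -> R) :
  (forall A, measurable A -> P (Z @^-1` A) = gaussian_law m s A) ->
  measurable_fun setT g -> (forall x, 0 <= g x) ->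
  'E_P[g \o Z]%E =
  if s == 0 then (g m)%:E
  else (\int[lebesgue_measure]_x (g x * normal_pdf m s x)%:E)%E.
Proof.
move=> lawZ mg g0; rewrite unlock.
have mg' : measurable_fun setT (EFin \o g) by exact/measurable_EFinP.
(* [normal_prob] is a measure on [measurableTypeR R], which has the Borel sets
   of R but another display; Z' is Z seen as a map into that type *)
have mZ : @measurable_fun _ _ T (measurableTypeR R) setT Z.
  by move=> _ A mA; exact: (measurable_funPT Z measurableT).
pose mZ_build := isMeasurableFun.Build _ _ T (measurableTypeR R) Z mZ.
pose Z' : {mfun T >-> measurableTypeR R} :=
  HB.pack (Z : T -> measurableTypeR R) mZ_build.
have -> : (\int[P]_w ((g \o Z) w)%:E = \int[distribution P Z']_x (g x)%:E)%E.
  by rewrite ge0_integral_distribution.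
move: lawZ; rewrite /gaussian_law; case: eqVneq => [s0|s0] lawZ.
  transitivity (\int[@dirac _ (measurableTypeR R) m R]_x (g x)%:E)%E.
    by apply: eq_measure_integral => A mA _; exact (lawZ A mA).
  by rewrite integral_dirac//= diracT mul1e.
rewrite -integral_normal_prob//.
by apply: eq_measure_integral => A mA _; exact (lawZ A mA).
Qed.

(** Completing the square: exp (t x) times the normal density at m is a
    constant times the normal density at m + t s^2. *)
Lemma gaussian_mgf (R : realType) (d : measure_display)
    (T : measurableType d) (P : probability T R) (Z : {mfun T >-> R})
    (m s : R) :
  (forall A, measurable A -> P (Z @^-1` A) = gaussian_law m s A) ->
  forall t, 'M_P Z t = (expR (t * m + t ^+ 2 * s ^+ 2 / 2))%:E.
Proof.
move=> lawZ t; rewrite /mmt_gen_fun.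
have -> : expR \o t \o* Z = (fun x => expR (t * x)) \o Z.
  by apply/funext => w /=; rewrite mulrC.
rewrite (integral_gaussian_law lawZ) => [| |x]; first last.
- exact: expR_ge0.
- by apply: measurableT_comp => //; exact: measurable_funM.
case: eqVneq => [->|s0]; first by rewrite expr0n /= mulr0 mul0r addr0.
set M := expR _.
under eq_integral => x _.
  have -> : expR (t * x) * normal_pdf m s x =
            M * normal_pdf (m + t * s ^+ 2) s x.
    rewrite !normal_pdfE// /normal_fun !(mulrCA _ (normal_peak s)).
    congr (_ * _); rewrite -!expRD; congr expR; field.
    by rewrite s0.
  over.
under eq_integral do rewrite EFinM.
rewrite integralZl//=; last exact: integrable_normal_pdf.
by rewrite integral_normal_pdf mule1.
Qed.

Lemma normal_peak_div (R : realType) (s w : R) :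
  0 < w -> normal_peak (s / w) = w * normal_peak s.
Proof.
move=> w0; rewrite /normal_peak.
have -> : (s / w) ^+ 2 * pi *+ 2 = w^-1 ^+ 2 * (s ^+ 2 * pi *+ 2).
  by rewrite exprMn; move: (@pi R) => q; ring.
by rewrite sqrtrM ?sqr_ge0// sqrtr_sqr ger0_norm ?invr_ge0 ?ltW// invfM invrK.
Qed.

(** The exponential factor turns the normal density of deviation s into 1 / w
    times the one of deviation s / w. *)
Lemma gaussian_expR_sqr (R : realType) (d : measure_display)
    (T : measurableType d) (P : probability T R) (Z : {mfun T >-> R})
    (m s : R) :
  (forall A, measurable A -> P (Z @^-1` A) = gaussian_law m s A) -> s != 0 ->
  forall w, 0 < w ->
  'E_P[fun y => expR (- ((w ^+ 2 - 1) / (2 * s ^+ 2) * (Z y - m) ^+ 2))]%E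
  = (w^-1)%:E.
Proof.
move=> lawZ s0 w w0.
have := @integral_gaussian_law _ _ _ _ _ _ _
  (fun x => expR (- ((w ^+ 2 - 1) / (2 * s ^+ 2) * (x - m) ^+ 2))) lawZ.
rewrite (negbTE s0) => ->; last first.
- by move=> x; exact: expR_ge0.
- apply: measurableT_comp => //; apply: measurableT_comp => //.
  apply: measurable_funM => //; apply: measurable_funX.
  exact: measurable_funB.
under eq_integral => x _.
  have -> : expR (- ((w ^+ 2 - 1) / (2 * s ^+ 2) * (x - m) ^+ 2)) *
     normal_pdf m s x = w^-1 * normal_pdf m (s / w) x.
    have sw0 : s / w != 0 by apply: mulf_neq0 => //; rewrite invr_eq0 gt_eqF.
    rewrite !normal_pdfE// /normal_fun mulrCA [in RHS]mulrA.
    rewrite normal_peak_div// mulKf ?gt_eqF//.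
    congr (_ * _); rewrite -!expRD; congr expR; field.
    by rewrite s0 gt_eqF.
  over.
under eq_integral do rewrite EFinM.
rewrite integralZl//=; last exact: integrable_normal_pdf.
by rewrite integral_normal_pdf mule1.
Qed.

(** * The parameters of a Gaussian law and the tail bound *)

(** Monotonicity when only the smaller variable is known to be integrable. *)
Lemma le_expectation (R : realType) (d : measure_display)
    (T : measurableType d) (P : probability T R) (X Y : T -> R) :
  X \in Lfun P 1 -> measurable_fun setT Y -> (forall w, 0 <= Y w) ->
  (forall w, X w <= Y w) -> ('E_P[X] <= 'E_P[Y])%E.
Proof.
move=> X1 mY Y0 XY; rewrite unlock.
have mY' : measurable_fun setT (EFin \o Y) by exact/measurable_EFinP.
have [->|Yfin] := eqVneq (\int[P]_w (Y w)%:E)%E +oo%E; first exact: leey.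
apply: le_integral => //.
- exact/Lfun1_integrable.
- apply/integrableP; split=> //.
  under eq_integral => w _ do rewrite gee0_abs ?lee_fin//.
  by rewrite ltey.
- by move=> w _; rewrite lee_fin.
Qed.

(** From 1 + t (Z - m) <= exp (t (Z - m)), the expectation of Z satisfies
    1 + t (mu - m) <= exp (t^2 s^2 / 2) for all t; the right-hand side is
    1 + O(t^2), so the linear term has to vanish. *)
Lemma gaussian_law_mean (R : realType) (d : measure_display)
    (T : measurableType d) (P : probability T R) (Z : {mfun T >-> R})
    (m s mu : R) :
  (forall A, measurable A -> P (Z @^-1` A) = gaussian_law m s A) ->
  (Z : T -> R) \in Lfun P 1 -> ('E_P[Z] = mu%:E)%E -> m = mu.
Proof.
move=> lawZ Z1 EZ; pose D := mu - m.
have mgf t : 1 + t * D <= expR (t ^+ 2 * s ^+ 2 / 2).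
  have : ('E_P[(expR (t * m) \o* (cst (1 - t * m) \+ t \o* Z))%R] <= 'M_P Z t)%E.
    apply: le_expectation.
    - by rewrite Lfun_scale//= rpredD//= ?Lfun_cst// Lfun_scale.
    - apply: measurableT_comp => //; apply: measurable_funM => //.
    - by move=> w /=; exact: expR_ge0.
    - move=> w /=; rewrite mulrC.
      have -> : expR (Z w * t) = expR (t * m) * expR (t * Z w - t * m).
        by rewrite -expRD; congr expR; ring.
      rewrite ler_pM2l ?expR_gt0//; apply: le_trans (expR_ge1Dx _).
      by lra.
  rewrite (gaussian_mgf lawZ) expectationZl; last first.
    by rewrite rpredD//= ?Lfun_cst// Lfun_scale.
  rewrite expectationD ?Lfun_cst// ?Lfun_scale// expectation_cst.
  rewrite expectationZl// EZ -!EFinM lee_fin expRD.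
  rewrite ler_pM2l ?expR_gt0//; apply: le_trans.
  by rewrite /D; lra.
apply/eqP; rewrite eq_sym -subr_eq0 -/D; apply/negPn/negP => D0.
have D2 : 0 < D ^+ 2 by rewrite exprn_even_gt0.
have s2 : 0 <= s ^+ 2 by exact: sqr_ge0.
(* t = D / k gives D^2 / k <= D^2 s^2 / k^2 as soon as D^2 <= k, hence
   k <= s^2 *)
pose k := 1 + s ^+ 2 + D ^+ 2.
have k0 : 0 < k by rewrite /k; lra.
have := mgf (D / k).
set y := _ ^+ 2 * _ / 2 => le_y.
have yE : y = D ^+ 2 * s ^+ 2 / k ^+ 2 / 2 by rewrite /y; field; rewrite gt_eqF.
have y_ge0 : 0 <= y by rewrite /y divr_ge0 // mulr_ge0 // sqr_ge0.
have y1 : (1 + D / k * D) * (1 - y) <= 1.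
  have [y1|y1] := lerP y 1; last first.
    apply: le_trans ler01; rewrite mulr_ge0_le0 ?subr_le0 ?(ltW y1)//.
    by rewrite addr_ge0// mulrAC -expr2 divr_ge0// ltW.
  rewrite -[leRHS](@expRxMexpNx_1 _ y) ler_pM ?subr_ge0//.
  - by rewrite addr_ge0// mulrAC -expr2 divr_ge0// ltW.
  - exact: expR_ge1Dx.
have DkE : D / k * D = D ^+ 2 / k by rewrite mulrAC -expr2.
have Dk1 : D ^+ 2 / k <= 1 by rewrite ler_pdivrMr// mul1r /k; lra.
have {y1} : D ^+ 2 / k <= 2 * y by rewrite DkE in y1; nra.
have -> : 2 * y = D ^+ 2 / k * (s ^+ 2 / k).
  by rewrite yE; field; rewrite gt_eqF.
rewrite -[leLHS]mulr1 ler_pM2l ?divr_gt0// ler_pdivlMr// mul1r /k.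
lra.
Qed.

(** With c = (w^2 - 1) / (2 s^2), the expectation of
    1 - c (Z - m)^2 <= exp (- c (Z - m)^2) gives 1 - c v <= 1 / w, that is
    2 s^2 <= v w (w + 1); let w decrease to 1. *)
Lemma gaussian_law_variance_ge (R : realType) (d : measure_display)
    (T : measurableType d) (P : probability T R) (Z : {mfun T >-> R})
    (m s v : R) :
  (forall A, measurable A -> P (Z @^-1` A) = gaussian_law m s A) ->
  (Z : T -> R) \in Lfun P 2%:E -> ('E_P[Z] = m%:E)%E -> ('V_P[Z] = v%:E)%E ->
  s ^+ 2 <= v.
Proof.
move=> lawZ Z2 EZ VZ.
have v0 : 0 <= v by rewrite -lee_fin -VZ variance_ge0.
have [->|s0] := eqVneq s 0; first by rewrite expr0n.
have s2 : 0 < s ^+ 2 by rewrite exprn_even_gt0.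
have Zm2 : (Z \- cst m : T -> R) \in Lfun P 2%:E.
  by rewrite rpredB//= ?lee1n// Lfun_cst.
have Zm1 := Lfun2_mul_Lfun1 Zm2 Zm2.
have {}VZ : ('E_P[((Z \- cst m) \* (Z \- cst m))%R] = v%:E)%E.
  by rewrite -VZ /variance [in RHS]unlock EZ.
have key w : 1 < w -> 2 * s ^+ 2 <= v * (w * (w + 1)).
  move=> w1; have w0 : 0 < w by lra.
  set c := (w ^+ 2 - 1) / (2 * s ^+ 2).
  have := gaussian_expR_sqr lawZ s0 w0; rewrite -/c => Ew.
  have : ('E_P[(cst 1 \- c \o* ((Z \- cst m) \* (Z \- cst m)))%R] <=
          'E_P[(fun y => expR (- (c * (Z y - m) ^+ 2)))%R])%E.
    apply: le_expectation.
    - by rewrite rpredB//= ?Lfun_cst// Lfun_scale.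
    - apply: measurableT_comp => //; apply: measurableT_comp => //.
      apply: measurable_funM => //; apply: measurable_funX.
      exact: measurable_funB.
    - by move=> y; exact: expR_ge0.
    - move=> y /=; apply: le_trans (expR_ge1Dx _).
      by lra.
  rewrite Ew expectationB ?Lfun_cst// ?Lfun_scale// expectation_cst.
  rewrite expectationZl// VZ -EFinM -EFinB lee_fin => le_w.
  have {le_w} : (1 - w^-1) <= c * v by lra.
  have -> : c * v = (1 - w^-1) * (v * (w * (w + 1)) / (2 * s ^+ 2)).
    by rewrite /c; field; rewrite s0 gt_eqF.
  rewrite -[leLHS]mulr1 ler_pM2l ?subr_gt0 ?invf_lt1//.
  by rewrite ler_pdivlMr ?mul1r// mulr_gt0.
rewrite leNgt; apply/negP => vs.
(* w = 1 + e with e <= 1, so that w * (w + 1) <= 2 + 4 * e; then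
   4 * e * s ^+ 2 = s ^+ 2 - v makes [key] contradict v < s ^+ 2 *)
pose e := (s ^+ 2 - v) / (4 * s ^+ 2).
have e0 : 0 < e by rewrite divr_gt0 ?subr_gt0// mulr_gt0.
have eE : 4 * s ^+ 2 * e = s ^+ 2 - v by rewrite /e mulrC divfK// gt_eqF// mulr_gt0.
have e1 : e <= 1 by rewrite /e ler_pdivrMr; lra.
have ee : e * e <= e by rewrite ler_piMl ?(ltW e0).
have := key (1 + e); rewrite ltrDl => /(_ e0).
have : v * ((1 + e) * (1 + e + 1)) <= v * (2 + 4 * e) by apply: ler_wpM2l => //; lra.
have : v * (4 * e) <= s ^+ 2 * (4 * e) by rewrite ler_wpM2r ?ltW// mulr_gt0.
lra.
Qed.

(** Chernoff's bound at t = x / V, for Z and for - Z. *)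
Lemma gaussian_tail (R : realType) (d : measure_display)
    (T : measurableType d) (P : probability T R) (Z : {mfun T >-> R})
    (mu v V : R) :
  (exists m s, forall A, measurable A -> P (Z @^-1` A) = gaussian_law m s A) ->
  (Z : T -> R) \in Lfun P 2%:E -> ('E_P[Z] = mu%:E)%E -> ('V_P[Z] = v%:E)%E ->
  v <= V -> 0 < V ->
  forall x, 0 < x ->
  (P [set w | (x <= `|Z w - mu|)%R] <= (2 * expR (- (x ^+ 2 / (2 * V))))%:E)%E.
Proof.
move=> [m [s lawZ]] Z2 EZ VZ vV V0 x x0.
have Z1 : (Z : T -> R) \in Lfun P 1 by apply: Lfun_subset12 Z2; exact: fin_num_measure.
have mmu := gaussian_law_mean lawZ Z1 EZ; rewrite {m}mmu in lawZ.
have sV : s ^+ 2 <= V := le_trans (gaussian_law_variance_ge lawZ Z2 EZ VZ) vV.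
pose t := x / V.
have t0 : 0 < t by rewrite divr_gt0.
have bound u a : u ^+ 2 = t ^+ 2 -> a = u * mu + t * x ->
    expR (u * mu + u ^+ 2 * s ^+ 2 / 2) * expR (- a)
    <= expR (- (x ^+ 2 / (2 * V))).
  move=> uE ->; rewrite -expRD ler_expR uE.
  have -> : - (x ^+ 2 / (2 * V)) = t ^+ 2 * V / 2 - t * x.
    by rewrite /t; field; rewrite gt_eqF.
  have : t ^+ 2 * s ^+ 2 <= t ^+ 2 * V by rewrite ler_wpM2l ?sqr_ge0.
  lra.
have up : (P [set w | (mu + x <= Z w)%R] <= (expR (- (x ^+ 2 / (2 * V))))%:E)%E.
  apply: le_trans (chernoff Z (mu + x) t0) _.
  by rewrite (gaussian_mgf lawZ) -EFinM lee_fin; apply: bound => //; ring.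
have low : (P [set w | (- mu + x <= - Z w)%R] <=
            (expR (- (x ^+ 2 / (2 * V))))%:E)%E.
  apply: le_trans (chernoff (- Z) (- mu + x) t0) _.
  have -> : 'M_P (- Z) t = 'M_P Z (- t).
    rewrite /mmt_gen_fun; congr expectation; apply/funext => w /=.
    by congr expR; rewrite mulrN mulNr.
  rewrite (gaussian_mgf lawZ) -EFinM lee_fin.
  by apply: bound; [rewrite sqrrN | ring].
have -> : [set w | x <= `|Z w - mu|] =
    [set w | mu + x <= Z w] `|` [set w | - mu + x <= - Z w].
  apply/seteqP; split => w /=.
    by rewrite ler_normr => /orP[H|H]; [left|right]; lra.
  by rewrite ler_normr => -[H|H]; apply/orP; [left|right]; lra.
have mge (f : {mfun T >-> R}) a : measurable [set w | a <= f w].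
  have -> : [set w | a <= f w] = f @^-1` `[a, +oo[.
    by apply/seteqP; split => w /=; rewrite in_itv /= andbT.
  exact: measurable_funPTI.
apply: le_trans (measureU2 _ _ _) _; rewrite ?mge//; first exact: (mge (- Z)).
by rewrite mulr_natl mulr2n EFinD; apply: leeD.
Qed.

(** * Linear combinations of a Gaussian vector *)

(** [covariance] centers by [fine 'E_P[X]], which is a real number whatever X
    is; so a finite variance puts X minus a constant in L^2, hence X. *)
Lemma variance_lty_Lfun2 (R : realType) (d : measure_display)
    (T : measurableType d) (P : probability T R) (X : {mfun T >-> R}) :
  ('V_P[X] < +oo)%E -> (X : T -> R) \in Lfun P 2%:E.
Proof.
rewrite /variance unlock; set c := fine _ => Vfin.
have mXc : measurable_fun setT (X \- cst c) by exact: measurable_funB.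
have -> : (X : T -> R) = (X \- cst c) \+ cst c.
  by apply/funext => w /=; rewrite subrK.
rewrite rpredD//= ?lee1n// => _; last exact: Lfun_cst.
rewrite inE; apply/andP; split; rewrite inE//=.
rewrite /finite_norm unlock /=; apply: poweR_lty.
move: Vfin; rewrite unlock; congr (_ < _)%E; apply: eq_integral => w _.
by rewrite /= powR_mulrn// real_normK ?num_real// expr2.
Qed.

Lemma Lfun_lincomb (R : realType) (d : measure_display)
    (T : measurableType d) (P : probability T R) (I : Type) (r : seq I)
    (a : I -> R) (X : I -> T -> R) :
  (forall i, X i \in Lfun P 2%:E) ->
  (fun w => \sum_(i <- r) a i * X i w) \in Lfun P 2%:E.
Proof.
move=> X2; elim: r => [|i r IH].
  under eq_fun do rewrite big_nil.
  exact: Lfun_cst.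
under eq_fun do rewrite big_cons mulrC.
by apply: rpredD => //=; rewrite ?lee1n// Lfun_scale// ler1n.
Qed.

Lemma expectation_lincomb (R : realType) (d : measure_display)
    (T : measurableType d) (P : probability T R) (I : Type) (r : seq I)
    (a m : I -> R) (X : I -> T -> R) :
  (forall i, X i \in Lfun P 2%:E) -> (forall i, 'E_P[X i] = (m i)%:E)%E ->
  ('E_P[fun w => (\sum_(i <- r) a i * X i w)%R] =
   (\sum_(i <- r) a i * m i)%R%:E)%E.
Proof.
move=> X2 EX.
have Pfin : P setT \is a fin_num := fin_num_measure P _ measurableT.
elim: r => [|i r IH].
  rewrite big_nil; under eq_fun do rewrite big_nil.
  exact: expectation_cst.
rewrite big_cons; under eq_fun do rewrite big_cons mulrC.
rewrite expectationD.
- by rewrite expectationZl ?EX ?IH ?EFinD ?EFinM// Lfun_subset12.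
- by rewrite Lfun_scale// Lfun_subset12.
- by rewrite Lfun_subset12// Lfun_lincomb.
Qed.

Lemma covariance_lincombl (R : realType) (d : measure_display)
    (T : measurableType d) (P : probability T R) (I : Type) (r : seq I)
    (a v : I -> R) (X : I -> T -> R) (Y : T -> R) :
  (forall i, X i \in Lfun P 2%:E) -> Y \in Lfun P 2%:E ->
  (forall i, covariance P (X i) Y = (v i)%:E) ->
  covariance P (fun w => \sum_(i <- r) a i * X i w) Y =
  (\sum_(i <- r) a i * v i)%:E.
Proof.
move=> X2 Y2 XY.
have Pfin : P setT \is a fin_num := fin_num_measure P _ measurableT.
elim: r => [|i r IH].
  rewrite big_nil; under eq_fun do rewrite big_nil.
  exact: covariance_cst_l.
rewrite big_cons; under eq_fun do rewrite big_cons mulrC.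
rewrite covarianceDl//.
- have X1 := Lfun_subset12 Pfin (X2 i); have Y1 := Lfun_subset12 Pfin Y2.
  have XY1 := Lfun2_mul_Lfun1 (X2 i) Y2.
  by rewrite covarianceZl// XY IH EFinD EFinM.
- by rewrite Lfun_scale// ler1n.
- exact: Lfun_lincomb.
Qed.

(** The measurability clause serves to compare, under the alternative, the event
    of a missed detection with this deviation event. *)
Lemma gaussian_vector_tail (R : realType) (d : measure_display)
    (T : measurableType d) (P : probability T R) (n : nat)
    (X : 'I_n -> {mfun T >-> R}) (mu : 'rV[R]_n) (Sigma : 'M[R]_n)
    (a : 'I_n -> R) (V x : R) :
  gaussian_vector P X mu Sigma ->
  \sum_(r < n) \sum_(s < n) a r * a s * Sigma r s <= V -> 0 < V -> 0 < x ->
  measurable [set w | x <= `|\sum_(k < n) a k * X k w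
                             - \sum_(k < n) a k * mu 0 k|] /\
  (P [set w | (x <= `|\sum_(k < n) a k * X k w
                      - \sum_(k < n) a k * mu 0 k|)%R]
   <= (2 * expR (- (x ^+ 2 / (2 * V))))%:E)%E.
Proof.
move=> [lawX EX covX] vV V0 x0.
have X2 k : (X k : T -> R) \in Lfun P 2%:E.
  by apply: variance_lty_Lfun2; rewrite /variance covX ltry.
pose f w := \sum_(k < n) a k * X k w.
have mf : measurable_fun setT f.
  by apply: measurable_sum => k; exact: measurable_funM.
pose f_build := isMeasurableFun.Build _ _ T R f mf.
pose Z : {mfun T >-> R} := HB.pack f f_build.
have EZ := expectation_lincomb (index_enum 'I_n) a X2 EX.
have covXZ k : covariance P (X k) Z = (\sum_(s < n) a s * Sigma s k)%:E.
  by rewrite covarianceC (@covariance_lincombl _ _ _ _ _ _ a (Sigma ^~ k)).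
have VZ : 'V_P[Z] = (\sum_(r < n) \sum_(s < n) a r * a s * Sigma r s)%:E.
  rewrite /variance (covariance_lincombl _ _ X2 _ covXZ); last exact: Lfun_lincomb.
  rewrite exchange_big /=; congr (_%:E); apply: eq_bigr => r _.
  by rewrite mulr_sumr; apply: eq_bigr => s _; rewrite mulrA (mulrC (a r)).
split; last exact: (gaussian_tail (Z := Z) (lawX a) (Lfun_lincomb _ _ X2) EZ VZ).
have mZ : measurable_fun setT (fun w => `|Z w - \sum_(k < n) a k * mu 0 k|).
  by apply: measurableT_comp => //; exact: measurable_funB.
have -> : [set w | x <= `|\sum_(k < n) a k * X k w - \sum_(k < n) a k * mu 0 k|]
  = (fun w => `|Z w - \sum_(k < n) a k * mu 0 k|) @^-1` `[x, +oo[.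
  by apply/seteqP; split => w /=; rewrite in_itv /= andbT.
by rewrite -[X in measurable X]setTI; apply: mZ.
Qed.

(** * The variance of the CUSUM statistic *)

Definition toeplitz_sum (R : realType) (g : nat -> R) (N : nat) : R :=
  \sum_(r < N) \sum_(s < N) g `|r - s|%N.

(** The sum of g |m| over - N <= m <= N. *)
Definition symmetric_sum (R : realType) (g : nat -> R) (N : nat) : R :=
  g 0%N + (\sum_(m < N) g m.+1) *+ 2.

(** The difference is the last row and the last column. *)
Lemma toeplitz_sumS (R : realType) (g : nat -> R) (N : nat) :
  toeplitz_sum g N.+1 = toeplitz_sum g N + symmetric_sum g N.
Proof.
rewrite /toeplitz_sum /symmetric_sum big_ord_recr /=.
under eq_bigr do rewrite big_ord_recr /=.
rewrite big_split /= big_ord_recr /= distnn -!addrA; congr (_ + _).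
have -> : \sum_(i < N) g `|N - i|%N = \sum_(i < N) g `|i - N|%N.
  by apply: eq_bigr => i _; rewrite distnC.
have -> : \sum_(i < N) g `|i - N|%N = \sum_(m < N) g m.+1.
  rewrite (reindex_inj rev_ord_inj) /=; apply: eq_bigr => i _.
  congr g; rewrite distnEr ?leq_subr// subKn//.
by rewrite addrA -mulr2n addrC.
Qed.

(** By [toeplitz_sumS], [toeplitz_sum g N / N%:R] is the arithmetic mean of the
    first N symmetric sums. *)
Lemma toeplitz_mean_cvg (R : realType) (g : nat -> R) (l : R) :
  symmetric_sum g N @[N --> \oo] --> l ->
  forall e, 0 < e -> exists2 N0, (0 < N0)%N &
  forall N, (N0 <= N)%N -> `|toeplitz_sum g N / N%:R - l| <= e.
Proof.
move=> /cesaro /cvgrPdist_le cvg e e0.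
have [N0 _ HN] := cvg _ e0; exists N0.+1 => // -[//|N] /HN /=.
rewrite distrC mulrC; congr (`|_ * _ - _| <= _).
elim: N.+1 => [|k IH]; first by rewrite /series /= big_nil /toeplitz_sum big_ord0.
by rewrite toeplitz_sumS seriesSr IH addrC.
Qed.

Lemma big_ord_geq (R : realType) (n t : nat) (F : nat -> R) :
  \sum_(k < n | (t <= k)%N) F k = \sum_(k < n - t) F (k + t)%N.
Proof. by rewrite -(big_geq_mkord _ _ xpredT) -{1}[t]add0n big_addn big_mkord. Qed.

(** Coefficients of the linear form whose absolute value is the CUSUM
    statistic ([cusumE]). *)
Definition cusum_weight (R : realType) (n t k : nat) : R :=
  Num.sqrt (t%:R * (n - t)%N%:R / n%:R) *
  (if (k < t)%N then - t%:R^-1 else (n - t)%N%:R^-1).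

Lemma sum_cusum_weight (R : realType) (n t : nat) (F : 'I_n -> R) :
  \sum_(k < n) cusum_weight R n t k * F k =
  Num.sqrt (t%:R * (n - t)%N%:R / n%:R) *
  ((n - t)%N%:R^-1 * (\sum_(k < n | (t <= k)%N) F k)
   - t%:R^-1 * (\sum_(k < n | (k < t)%N) F k)).
Proof.
rewrite !mulr_sumr [X in X - _]big_mkcond [X in _ - X]big_mkcond -sumrB mulr_sumr.
apply: eq_bigr => k _; rewrite /cusum_weight; set q := Num.sqrt _.
rewrite -mulrA; congr (_ * _).
by case: ltnP => _ /=; rewrite ?subr0 ?sub0r ?mulNr.
Qed.

Lemma cusumE (R : realType) (n t : nat) (x : 'rV[R]_n) :
  cusum t x = `|\sum_(k < n) cusum_weight R n t k * x 0 k|.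
Proof. by rewrite sum_cusum_weight normrM ger0_norm ?sqrtr_ge0. Qed.

Lemma cusum_weight_zeta (R : realType) (n t : nat) (b : R) :
  (0 < t < n)%N ->
  \sum_(k < n) cusum_weight R n t k * (((b / 2) *: zeta R n t) 0 k) =
  b * Num.sqrt (t%:R * (n - t)%N%:R / n%:R).
Proof.
move=> /andP[t0 tn]; rewrite sum_cusum_weight mulrC; congr (_ * _).
have -> : \sum_(k < n | (t <= k)%N) ((b / 2) *: zeta R n t) 0 k =
          (b / 2) * (n - t)%:R.
  under eq_bigr => k tk do rewrite !mxE ltnNge tk mulr1.
  by rewrite (big_ord_geq n t (fun=> b / 2)) sumr_const card_ord mulr_natr.
have -> : \sum_(k < n | (k < t)%N) ((b / 2) *: zeta R n t) 0 k =
          - (b / 2) * t%:R.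
  under eq_bigr => k tk do rewrite !mxE tk mulrN1.
  rewrite -(big_ord_widen n (fun=> - (b / 2)) (ltnW tn)).
  by rewrite sumr_const card_ord mulr_natr.
by field; rewrite !pnatr_eq0 -!lt0n t0 subn_gt0 tn.
Qed.

(** The polarized form of
    Z_t ^ 2 = T1 ^ 2 / t + T2 ^ 2 / (n - t) - (T1 + T2) ^ 2 / n. *)
Lemma cusum_weightM (R : realType) (n t r s : nat) : (0 < t < n)%N ->
  cusum_weight R n t r * cusum_weight R n t s =
  (if (r < t)%N && (s < t)%N then t%:R^-1 else 0) +
  (if (t <= r)%N && (t <= s)%N then (n - t)%N%:R^-1 else 0) - n%:R^-1.
Proof.
move=> /andP[t0 tn]; rewrite /cusum_weight mulrACA -expr2 sqr_sqrtr; last first.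
  by rewrite divr_ge0// mulr_ge0.
have t0' : t%:R != 0 :> R by rewrite pnatr_eq0 -lt0n.
have nt0 : (n - t)%N%:R != 0 :> R by rewrite pnatr_eq0 -lt0n subn_gt0.
have nE : n%:R = t%:R + (n - t)%N%:R :> R by rewrite -natrD subnKC// ltnW.
have n0 : n%:R != 0 :> R by rewrite pnatr_eq0 -lt0n (ltn_trans t0).
rewrite nE in n0 *.
by case: (ltnP r t) => _; case: (ltnP s t) => _ /=; field; rewrite ?n0 ?t0' ?nt0.
Qed.

Lemma cusum_variance (R : realType) (n t : nat) (g : nat -> R) :
  (0 < t < n)%N ->
  \sum_(r < n) \sum_(s < n)
    cusum_weight R n t r * cusum_weight R n t s * g `|r - s|%N =
  toeplitz_sum g t / t%:R + toeplitz_sum g (n - t) / (n - t)%N%:R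
  - toeplitz_sum g n / n%:R.
Proof.
move=> tn; have /andP[_ /ltnW ltn] := tn.
under eq_bigr => r _ do under eq_bigr => s _ do
  rewrite cusum_weightM// mulrBl mulrDl.
under eq_bigr do rewrite sumrB big_split /=.
rewrite sumrB big_split /=; congr (_ + _ - _).
- rewrite /toeplitz_sum.
  rewrite (big_ord_widen n (fun r => \sum_(s < t) g `|r - s|%N) ltn).
  rewrite mulr_suml [RHS]big_mkcond.
  apply: eq_bigr => r _; case: ltnP => _ /=; last first.
    by rewrite big1// => s _; rewrite mul0r.
  rewrite (big_ord_widen n (fun s => g `|r - s|%N) ltn) mulr_suml [RHS]big_mkcond.
  by apply: eq_bigr => s _; case: ltnP; rewrite ?mul0r // mulrC.
- transitivity (\sum_(r < n | (t <= r)%N) \sum_(s < n | (t <= s)%N)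
                  g `|r - s|%N / (n - t)%N%:R).
    rewrite [RHS]big_mkcond; apply: eq_bigr => r _; case: leqP => _ /=; last first.
      by rewrite big1// => s _; rewrite mul0r.
    rewrite [RHS]big_mkcond.
    by apply: eq_bigr => s _; case: leqP; rewrite ?mul0r // mulrC.
  rewrite (big_ord_geq n t (fun r => \sum_(s < n | (t <= s)%N)
                  g `|r - s|%N / (n - t)%N%:R)) mulr_suml.
  apply: eq_bigr => r _.
  rewrite (big_ord_geq n t (fun s => g `|r + t - s|%N / (n - t)%N%:R)) mulr_suml.
  by apply: eq_bigr => s _; rewrite distnDr.
- rewrite /toeplitz_sum mulr_suml; apply: eq_bigr => r _.
  by rewrite mulr_suml; apply: eq_bigr => s _; rewrite mulrC.
Qed.

Definition autocov (R : realType) (f : R -> R) (m : nat) : R :=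
  complex.Re (fourier_coef f m%:Z).

(** * The spectral density at 0 *)

Lemma Re_fourier_coefE (R : realType) (f : R -> R) (m : int) :
  complex.Re (fourier_coef f m) = (2 * pi)^-1 *
  Rintegral lebesgue_measure `[- pi, pi] (fun w => f w * cos (m%:~R * w)).
Proof.
rewrite /fourier_coef /cintegral /= mul0r subr0; congr (_ * _).
by apply: eq_Rintegral => w _ /=; rewrite mul0r subr0 cosN.
Qed.

Lemma Re_fourier_coef (R : realType) (f : R -> R) (m : int) :
  complex.Re (fourier_coef f m) = autocov f `|m|%N.
Proof.
rewrite /autocov !Re_fourier_coefE; congr (_ * _).
apply: eq_Rintegral => w _; congr (_ * _).
case: m => k //=.
by rewrite NegzE intrN mulNr cosN.
Qed.

Lemma Re_fourier_sum0 (R : realType) (f : R -> R) (N : nat) :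
  complex.Re (fourier_sum f N 0) = symmetric_sum (autocov f) N.
Proof.
rewrite /fourier_sum raddf_sum.
transitivity (\sum_(k < N.*2.+1) autocov f `|k - N|%N).
  apply: eq_bigr => k _; rewrite -Re_fourier_coef mulr0 /cexpi cos0 sin0.
  by case: (fourier_coef _ _) => a b /=; rewrite mulr1 mulr0 subr0.
rewrite -addnn -addnS big_split_ord /= big_ord_recl /= addn0 distnn addrCA /symmetric_sum.
congr (_ + _); rewrite mulr2n; congr (_ + _).
  rewrite (reindex_inj rev_ord_inj) /=; apply: eq_bigr => i _; congr autocov.
  by rewrite distnEr ?leq_subr// subKn.
by apply: eq_bigr => i _; rewrite /bump /= distnEl ?leq_addr// addKn.
Qed.

(** The Fourier series of f at 0, read on real parts. *)
Lemma symmetric_sum_autocov_cvg (R : realType) (c lambda : R) (f : R -> R) :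
  spectral_density c lambda f ->
  symmetric_sum (autocov f) N @[N --> \oo] --> f 0.
Proof.
move=> sf; have pi0 : 0 <= (pi : R) := pi_ge0 R.
have := spd_series sf (w := 0); rewrite in_itv /= oppr_le0 pi0 => /(_ isT).
move=> /cvgrPdist_lt cvg; apply/cvgrPdist_lt => e e0.
have e0' : 0 < e%:C by rewrite ltcR.
have [N0 _ HN] := cvg _ e0'; exists N0 => // N /HN /=.
rewrite -Re_fourier_sum0 => H; rewrite -ltcR; apply: le_lt_trans H.
by have := normc_ge_Re ((f 0)%:C - fourier_sum f N 0); rewrite raddfB.
Qed.

Lemma spectral_density_gt0 (R : realType) (c lambda : R) (f : R -> R) :
  spectral_density c lambda f -> 0 < f 0.
Proof.
move=> sf; have pi0 : 0 <= (pi : R) := pi_ge0 R.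
rewrite -lte_fin; apply: lt_le_trans (spd_inf_gt0 sf) _.
by apply: ereal_inf_lbound; exists 0 => //=; rewrite in_itv /= oppr_le0 pi0.
Qed.

Lemma autocov_toeplitz (R : realType) (n : nat) (f : R -> R) (Sigma : 'M[R]_n) :
  map_mx (fun x : R => x%:C) Sigma = toeplitz n f ->
  forall r s, Sigma r s = autocov f `|r - s|%N.
Proof.
move=> /matrixP E r s; have := E r s; rewrite !mxE => /(congr1 (@complex.Re R)).
by rewrite Re_fourier_coef absz_id.
Qed.

(** Each of the three means in [cusum_variance] is within
    theta * f 0 / 3 of f 0. *)
Lemma cusum_variance_le (R : realType) (c lambda : R) (f : R -> R) (theta : R) :
  spectral_density c lambda f -> 0 < theta ->
  exists2 N0, (0 < N0)%N & forall n t : nat, (t < n)%N ->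
    (N0 <= t)%N -> (N0 <= n - t)%N ->
    forall Sigma : 'M[R]_n, map_mx (fun x : R => x%:C) Sigma = toeplitz n f ->
    \sum_(r < n) \sum_(s < n)
      cusum_weight R n t r * cusum_weight R n t s * Sigma r s
    <= (1 + theta) * f 0.
Proof.
move=> sf theta0; have f0 := spectral_density_gt0 sf.
have e0 : 0 < theta * f 0 / 3 by rewrite divr_gt0// mulr_gt0.
have [N0 N00 HN] := toeplitz_mean_cvg (symmetric_sum_autocov_cvg sf) e0.
exists N0 => // n t tn N0t N0nt Sigma /autocov_toeplitz SigmaE.
under eq_bigr do under eq_bigr do rewrite SigmaE.
rewrite cusum_variance; last by rewrite tn (leq_trans N00).
have := HN _ N0t; have := HN _ N0nt.
have := HN n (leq_trans N0t (ltnW tn)).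
rewrite !ler_norml => /andP[+ _] /andP[_ +] /andP[_ +].
lra.
Qed.

(** * The error probabilities *)

(** A positive threshold rules out the default value 0 of the maximum. *)
Lemma cusum_testP (R : realType) (n : nat) (alpha thr : R) (x : 'rV[R]_n) :
  0 < thr ->
  reflect (exists2 t : 'I_n.+1, change_points n alpha t & thr <= cusum t x)
          (cusum_test alpha thr x).
Proof.
move=> thr0; apply: (iffP (bigmax_geP _ _ _ _)); last by right.
by case=> //; rewrite leNgt thr0.
Qed.

(** Union bound over the candidate change points for the error of the first
    kind; a missed detection at t implies that the statistic at t itself stays
    below the threshold. *)
Lemma error_prob_cusum_le (R : realType) (d : measure_display)
    (T : measurableType d) (n : nat) (alpha thr p q : R)
    (X : 'I_n -> {mfun T >-> R}) (P0 : probability T R)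
    (P1 : nat -> probability T R) :
  0 < thr -> 0 <= p -> 0 <= q ->
  (forall t, measurable [set w | thr <= cusum t (observation X w)]) ->
  (forall t, change_points n alpha t ->
     (P0 [set w | (thr <= cusum t (observation X w))%R] <= p%:E)%E) ->
  (forall t, change_points n alpha t ->
     (P1 t [set w | (cusum t (observation X w) < thr)%R] <= q%:E)%E) ->
  (error_prob alpha X P0 P1 (cusum_test alpha thr)
     <= (n.+1%:R * p + q)%:E)%E.
Proof.
move=> thr0 p0 q0 mA leA leB.
pose A t := if change_points n alpha t
            then [set w | thr <= cusum t (observation X w)] else set0.
have mA' t : measurable (A t) by rewrite /A; case: ifP.
have testE : [set w | cusum_test alpha thr (observation X w)] =
             \big[setU/set0]_(t < n.+1) A t.
  rewrite -bigcup_mkord; apply/seteqP; split => w /=.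
    by move=> /(cusum_testP _ _ thr0)[t ct le_t]; exists t => //=; rewrite /A ct.
  move=> [t /= tn]; rewrite /A; case: ifP => // ct le_t.
  by apply/(cusum_testP _ _ thr0); exists (Ordinal tn).
have mtest : measurable [set w | cusum_test alpha thr (observation X w)].
  by rewrite testE; apply: bigsetU_measurable.
rewrite /error_prob EFinD; apply: leeD.
  rewrite testE; apply: le_trans (Boole_inequality _ _) _ => //.
  have -> : (n.+1%:R * p)%:E = (\sum_(t < n.+1) p%:E)%E.
    by rewrite sumEFin sumr_const card_ord mulr_natl.
  apply: lee_sum => t _; rewrite /A; case: ifP => [/leA//|_].
  by rewrite measure0 lee_fin.
apply: bigmax_le => [|t ct]; first by rewrite lee_fin.
apply: le_trans (leB _ ct); apply: le_measure; rewrite ?inE.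
- have -> : [set w | ~~ cusum_test alpha thr (observation X w)] =
            ~` [set w | cusum_test alpha thr (observation X w)].
    by apply/seteqP; split => w /= /negP.
  exact: measurableC.
- have -> : [set w | cusum t (observation X w) < thr] =
            ~` [set w | thr <= cusum t (observation X w)].
    by apply/seteqP; split => w /=; rewrite ltNge => /negP.
  exact: measurableC.
- move=> w /= ntest; rewrite ltNge; apply: contra ntest => le_t.
  by apply/cusum_testP => //; exists t.
Qed.

(** The last bound is (t - alpha n) ((1 - alpha) n - t) >= 0. *)
Lemma change_points_bounds (R : realType) (n t : nat) (alpha : R) :
  (0 < n)%N -> 0 < alpha -> change_points n alpha t ->
  [/\ (t < n)%N, alpha * n%:R <= t%:R, alpha * n%:R <= (n - t)%N%:R &
      n%:R * alpha * (1 - alpha) <= t%:R * (n - t)%N%:R / n%:R].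
Proof.
move=> n0 a0 /andP[lo hi].
have n0' : 0 < n%:R :> R by rewrite ltr0n.
have tn : (t < n)%N.
  by rewrite -(ltr_nat R) (le_lt_trans hi)// gtr_pMl//; lra.
have ntE : (n - t)%N%:R = n%:R - t%:R :> R by rewrite natrB// ltnW.
split=> //; first by rewrite ntE; lra.
rewrite ler_pdivlMr// ntE.
have : 0 <= (t%:R - alpha * n%:R) * ((1 - alpha) * n%:R - t%:R).
  by rewrite mulr_ge0 ?subr_ge0.
lra.
Qed.

Lemma cusum_observationE (R : realType) (d : measure_display)
    (T : measurableType d) (n t : nat) (X : 'I_n -> {mfun T >-> R}) (w : T) :
  cusum t (observation X w) = `|\sum_(k < n) cusum_weight R n t k * X k w|.
Proof. by rewrite cusumE; congr `|_|; apply: eq_bigr => k _; rewrite mxE. Qed.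

Lemma measurable_cusum_observation (R : realType) (d : measure_display)
    (T : measurableType d) (n t : nat) (X : 'I_n -> {mfun T >-> R}) (x : R) :
  measurable [set w | x <= cusum t (observation X w)].
Proof.
have mf : measurable_fun setT
    (fun w => `|\sum_(k < n) cusum_weight R n t k * X k w|).
  apply: measurableT_comp => //; apply: measurable_sum => k.
  exact: measurable_funM.
have -> : [set w | x <= cusum t (observation X w)] =
    (fun w => `|\sum_(k < n) cusum_weight R n t k * X k w|) @^-1` `[x, +oo[.
  by apply/seteqP; split => w /=; rewrite in_itv /= andbT cusum_observationE.
by rewrite -[X in measurable X]setTI; apply: mf.
Qed.

Lemma cusum_tail_null (R : realType) (d : measure_display)
    (T : measurableType d) (P : probability T R) (n t : nat)
    (X : 'I_n -> {mfun T >-> R}) (Sigma : 'M[R]_n) (V x : R) :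
  gaussian_vector P X 0 Sigma ->
  \sum_(r < n) \sum_(s < n)
    cusum_weight R n t r * cusum_weight R n t s * Sigma r s <= V ->
  0 < V -> 0 < x ->
  (P [set w | (x <= cusum t (observation X w))%R]
   <= (2 * expR (- (x ^+ 2 / (2 * V))))%:E)%E.
Proof.
move=> gX vV V0 x0; have [_] := gaussian_vector_tail gX vV V0 x0.
have mean0 : \sum_(k < n) cusum_weight R n t k * (0 : 'rV[R]_n) 0 k = 0.
  by rewrite big1// => k _; rewrite mxE mulr0.
congr (P _ <= _)%E; apply/seteqP.
by split => w /=; rewrite cusum_observationE mean0 subr0.
Qed.

(** If |Z| < x while the mean of Z is at least 2 x in absolute value, then Z is
    at distance at least x from its mean. *)
Lemma cusum_tail_alt (R : realType) (d : measure_display)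
    (T : measurableType d) (P : probability T R) (n t : nat)
    (X : 'I_n -> {mfun T >-> R}) (Sigma : 'M[R]_n) (b V x : R) :
  (0 < t < n)%N ->
  gaussian_vector P X ((b / 2) *: zeta R n t) Sigma ->
  \sum_(r < n) \sum_(s < n)
    cusum_weight R n t r * cusum_weight R n t s * Sigma r s <= V ->
  0 < V -> 0 < x ->
  2 * x <= `|b| * Num.sqrt (t%:R * (n - t)%N%:R / n%:R) ->
  (P [set w | (cusum t (observation X w) < x)%R]
   <= (2 * expR (- (x ^+ 2 / (2 * V))))%:E)%E.
Proof.
move=> tn gX vV V0 x0 le_b; have [mA] := gaussian_vector_tail gX vV V0 x0.
rewrite cusum_weight_zeta// in mA *; apply: le_trans; apply: le_measure; rewrite ?inE//.
  have -> : [set w | cusum t (observation X w) < x] =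
            ~` [set w | x <= cusum t (observation X w)].
    by apply/seteqP; split => w /=; rewrite ltNge => /negP.
  by apply: measurableC; exact: measurable_cusum_observation.
move=> w /=; rewrite cusum_observationE distrC => lt_x.
have := lerB_dist (b * Num.sqrt (t%:R * (n - t)%N%:R / n%:R))
          (\sum_(k < n) cusum_weight R n t k * X k w).
rewrite normrM (@ger0_norm _ (Num.sqrt _)) ?sqrtr_ge0//.
lra.
Qed.

Theorem theorem5p2 (R : realType) (c lambda : R) (hc : 0 < c)
    (hlambda : 0 < lambda) :
  exists C : R, 0 < C /\
  forall (f : R -> R), spectral_density c lambda f ->
  forall (vartheta alpha : R), 0 < vartheta -> 0 < alpha -> alpha < 1 / 2 ->
  exists (n0 : nat) (thr : nat -> R -> R),
    (forall (n : nat) (delta : R), 0 < delta -> delta < 1 ->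
       0 < thr n delta) /\
    forall (n : nat) (delta b : R),
      0 < delta -> delta < 1 -> (n0 <= n)%N -> b != 0 ->
      C * Num.sqrt ((1 + vartheta) * f 0 / (n%:R * alpha * (1 - alpha)) *
                    ln (n%:R * (1 - 2 * alpha) / delta)) <= `|b| ->
    forall (d : measure_display) (T : measurableType d)
      (X : 'I_n -> {mfun T >-> R}) (Sigma : 'M[R]_n)
      (P0 : probability T R) (P1 : nat -> probability T R),
      map_mx (fun x : R => x%:C) Sigma = toeplitz n f ->
      gaussian_vector P0 X 0 Sigma ->
      (forall t : nat, change_points n alpha t ->
         gaussian_vector (P1 t) X ((b / 2) *: zeta R n t) Sigma) ->
      (error_prob alpha X P0 P1 (cusum_test alpha (thr n delta))
         <= delta%:E)%E.
Proof.
exists 4; split=> // f sf vartheta alpha vartheta0 alpha0 alpha2.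
have f0 := spectral_density_gt0 sf.
have [N0 N00 var_le] := cusum_variance_le sf vartheta0.
pose V := (1 + vartheta) * f 0; have V0 : 0 < V by rewrite mulr_gt0//; lra.
have gap0 : 0 < 1 - 2 * alpha by lra.
(* the first term makes t and n - t at least N0; the second one gives
   N^2 >= 8 n >= 4 (n + 1) for N = n (1 - 2 alpha) *)
pose K := N0%:R / alpha + 8 / (1 - 2 * alpha) ^+ 2.
have K0 : 0 <= K by rewrite addr_ge0 ?divr_ge0 ?sqr_ge0 ?(ltW alpha0).
pose n0 := (Num.bound K).+1.
have large n : (n0 <= n)%N -> [/\ (0 < n)%N, N0%:R <= alpha * n%:R &
    4 * n.+1%:R <= (n%:R * (1 - 2 * alpha)) ^+ 2].
  move=> n0n; have n1 : (0 < n)%N by exact: leq_trans n0n.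
  have n1' : 1 <= n%:R :> R by rewrite ler1n.
  have Kn : K <= n%:R.
    by rewrite (le_trans (ltW (archi_boundP K0)))// ler_nat ltnW.
  have A0 : 0 <= N0%:R / alpha by rewrite divr_ge0 // ltW.
  have B0 : 0 <= 8 / (1 - 2 * alpha) ^+ 2 by rewrite divr_ge0 ?sqr_ge0.
  split=> //.
    by rewrite mulrC -ler_pdivrMr//; move: Kn; rewrite /K; lra.
  have : 8 <= n%:R * (1 - 2 * alpha) ^+ 2.
    by rewrite -ler_pdivrMr ?exprn_gt0//; move: Kn; rewrite /K; lra.
  move/(ler_wpM2l (ler0n R n)); rewrite exprMn -[n.+1]addn1 natrD.
  lra.
pose L n delta : R := ln (n%:R * (1 - 2 * alpha) / delta).
pose thr n delta := if (n0 <= n)%N then 2 * Num.sqrt (V * L n delta) else 1.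
have ratio n delta : 0 < delta -> delta < 1 -> (n0 <= n)%N ->
    1 < n%:R * (1 - 2 * alpha) / delta.
  move=> delta0 delta1 /large[n1 _ n2].
  have N0' : 0 < n%:R * (1 - 2 * alpha) by rewrite mulr_gt0// ltr0n.
  have n3 : 1 <= n.+1%:R :> R by rewrite ler1n.
  by rewrite ltr_pdivlMr// mul1r; nra.
have L0 n delta : 0 < delta -> delta < 1 -> (n0 <= n)%N -> 0 < L n delta.
  by move=> *; rewrite ln_gt0// ratio.
exists n0, thr; split=> [n delta delta0 delta1|].
  rewrite /thr; case: ifP => // n0n.
  by rewrite mulr_gt0// sqrtr_gt0 mulr_gt0// L0.
move=> n delta b delta0 delta1 n0n _ le_b d T X Sigma P0 P1 SigmaE gX0 gX1.
have [n1 N0n n2] := large _ n0n.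
have VL0 : 0 < V * L n delta by rewrite mulr_gt0// L0.
rewrite /thr n0n; set x := 2 * _.
have x0 : 0 < x by rewrite mulr_gt0// sqrtr_gt0.
have pE : 2 * expR (- (x ^+ 2 / (2 * V))) =
          2 * (delta / (n%:R * (1 - 2 * alpha))) ^+ 2.
  have -> : x ^+ 2 / (2 * V) = L n delta *+ 2.
    by rewrite exprMn sqr_sqrtr ?ltW//; field; rewrite gt_eqF.
  rewrite -mulNrn mulr2n expRD -expr2 expRN /L.
  by rewrite lnK ?posrE ?(lt_trans ltr01) ?ratio// invf_div.
have p_le : 4 * n.+1%:R * (2 * expR (- (x ^+ 2 / (2 * V)))) <= 2 * delta.
  have N0' : 0 < n%:R * (1 - 2 * alpha) by rewrite mulr_gt0// ltr0n.
  rewrite pE expr_div_n mulrA mulrA ler_pdivrMr ?exprn_gt0//.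
  have delta2 : delta ^+ 2 <= delta by rewrite expr2 ler_piMl// ltW.
  have -> : 4 * n.+1%:R * 2 * delta ^+ 2 = 2 * (delta ^+ 2 * (4 * n.+1%:R)).
    by ring.
  by rewrite -[leRHS]mulrA ler_pM2l// ler_pM ?sqr_ge0.
set p := 2 * expR _ in pE p_le.
have p0 : 0 <= p by rewrite mulr_ge0// expR_ge0.
have facts t : change_points n alpha t -> (0 < t < n)%N /\
    \sum_(r < n) \sum_(s < n)
      cusum_weight R n t r * cusum_weight R n t s * Sigma r s <= V.
  move=> /(change_points_bounds n1 alpha0)[tn lo hi _].
  have N0t : (N0 <= t)%N by rewrite -(ler_nat R) (le_trans N0n).
  split; first by rewrite tn (leq_trans N00).
  by apply: var_le => //; rewrite -(ler_nat R) (le_trans N0n).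
apply: le_trans (@error_prob_cusum_le _ _ _ _ _ _ p p _ _ _ x0 p0 p0 _ _ _) _.
- by move=> t; exact: measurable_cusum_observation.
- by move=> t /facts[_ vV]; exact: cusum_tail_null vV V0 x0.
- move=> t ct; have [tn vV] := facts t ct.
  apply: cusum_tail_alt (gX1 t ct) vV V0 x0 _ => //.
  have [_ _ _ le_t] := change_points_bounds n1 alpha0 ct.
  have nt0 : 0 < n%:R * alpha * (1 - alpha).
    by rewrite !mulr_gt0 ?ltr0n//; lra.
  apply: le_trans (ler_wpM2r (sqrtr_ge0 _) le_b).
  rewrite -/V -/(L n delta) -[leRHS]mulrA -sqrtrM; last first.
    by rewrite mulrAC divr_ge0// ltW.
  have -> : 2 * x = 4 * Num.sqrt (V * L n delta) by rewrite /x; ring.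
  rewrite ler_pM2l// ler_wsqrtr//.
  have -> : V / (n%:R * alpha * (1 - alpha)) * L n delta *
      (t%:R * (n - t)%N%:R / n%:R) = V * L n delta *
      (t%:R * (n - t)%N%:R / n%:R / (n%:R * alpha * (1 - alpha))) by ring.
  by rewrite -[leLHS]mulr1 ler_pM2l// ler_pdivlMr// mul1r.
rewrite lee_fin.
have : 1 <= n.+1%:R :> R by rewrite ler1n.
nra.
Qed.
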